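(* Let $\phi=(\phi_{t,s})_{0\le s\le t\le T}$ be a stable almost flow on the Banach space $V$. Then, for a sufficiently small time horizon, the following holds: there exist $T_0\in(0,T]$ and a constant $L\ge 0$ (depending only on the time horizon, on $\delta$, $\varkappa$, $\omega$, $\widehat\phi$, $\phi^{\circledast}$ and on the constant $C$ in the bound $\|\phi_{t,s,r}\|_{\mathrm{Lip}}\le C\varpi(\omega_{r,t})$) such that for any partition $\pi$ of $[0,T_0]$, $$\|\phi^\pi_{t,s}-\phi_{t,s}\|_{\mathrm{Lip}}\le L\,\varpi(\omega_{s,t})\qquad\text{for all }0\le s\le t\le T_0 .$$ In particular, $\phi$ satisfies the uniform Lipschitz (UL) condition up to changing $\delta$: there is a non-decreasing function $\delta'$ with $\delta'_{T'}\to0$ as $T'\to 0$ such that $\|\phi^\pi_{t,s}\|_{\mathrm{Lip}}\le 1+\delta'_{T'}$ for every $T'\in(0,T_0]$, every partition $\pi$ of $[0,T']$ and all $0\le s\le t\le T'$.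
   Context: Setting. $(V,|\cdot|)$ is a Banach space and $T>0$ a time horizon. For $f:V\to V$, $\|f\|_\infty=\sup_a|f(a)|$ and $\|f\|_{\mathrm{Lip}}=\sup_{a\ne b}|f(a)-f(b)|/|a-b|$. A control $\omega$ is a family of numbers $\omega_{s,t}\ge0$, $0\le s\le t\le T$, which is super-additive ($\omega_{r,s}+\omega_{s,t}\le\omega_{r,t}$ for $r\le s\le t$), continuous near the diagonal, with $\omega_{s,s}=0$. A remainder $\varpi:[0,\omega_{0,T}]\to\mathbb R_+$ is a continuous increasing function such that for some $0<\varkappa<1$, $2\varpi(\tau/2)\le\varkappa\varpi(\tau)$ for $\tau>0$. $\delta:\mathbb R_+\to\mathbb R_+$, $T'\mapsto\delta_{T'}$, is non-decreasing with $\lim_{T'\to0}\delta_{T'}=0$. 4-points control. A function $f:V\to V$ satisfies a 4-points control if there are a non-decreasing continuous function $\widehat f:\mathbb R_+\to\mathbb R_+$ and a constant $f^\dagger\ge0$ such that for all $a,b,c,d\in V$, $$|f(a)-f(b)-f(c)+f(d)|\le\widehat f(|a-b|\vee|c-d|)\,(|a-c|\vee|b-d|)+f^\dagger|a-b-c+d|.$$ Stable almost flow. A family of continuous maps $\phi_{t,s}:V\to V$, $0\le s\le t\le T$, is a stable almost flow if, with $\phi_{t,s,r}:=\phi_{t,s}\circ\phi_{s,r}-\phi_{t,r}$, there are such a $\delta$ and constants $M,C\ge0$ such that for every $T'\in(0,T]$ and all $0\le r\le s\le t\le T'$: (a) $\phi_{t,t}=\mathrm{id}$; $\|\phi_{t,s}-\mathrm{id}\|_\infty\le\delta_{T'}$;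 $\|\phi_{t,s}\|_{\mathrm{Lip}}\le1+\delta_{T'}$; $\|\phi_{t,s,r}\|_\infty\le M\varpi(\omega_{r,t})$; (b) each $\phi_{t,s}$ satisfies a 4-points control with some $\widehat\phi_{t,s}$ and $\phi^\dagger_{t,s}\le1+\delta_{T'}$, and it is $\varpi$-compatible: $\widehat\phi_{t,s}\le\widehat\phi_{v,u}$ whenever $[s,t]\subset[u,v]$, and $\widehat\phi_{t,s}(\alpha\varpi(\omega_{s,t}))\le\phi^{\circledast}(\alpha)\varpi(\omega_{s,t})$ for all $\alpha\ge0$, where $\phi^\circledast:\mathbb R_+\to\mathbb R_+$ is a function not depending on $(s,t)$; (c) $\|\phi_{t,s,r}\|_{\mathrm{Lip}}\le C\varpi(\omega_{r,t})$. Iterated product. For a partition $\pi$ of the time interval, and $s\le t$, if $t_i<\dots<t_j$ are the points of $\pi$ in $[s,t]$, $\phi^\pi_{t,s}:=\phi_{t,t_j}\circ\phi_{t_j,t_{j-1}}\circ\dots\circ\phi_{t_{i+1},t_i}\circ\phi_{t_i,s}$; if there are none, $\phi^\pi_{t,s}:=\phi_{t,s}$.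
   Formalization: The horizon T_0 and the constant L may also depend on M (the sup-norm bound of the defect) and on ϖ, since independence of them is false; and ϖ(0)=0 is required, which is automatic unless ω_{0,T}=0. *)

(* Defs.v *)
From HB Require Import structures.
From mathcomp Require Import all_boot all_order all_algebra.
From mathcomp Require Import all_classical all_reals all_analysis.

Set Implicit Arguments.
Unset Strict Implicit.
Unset Printing Implicit Defensive.

Import Order.TTheory GRing.Theory Num.Theory.
Import numFieldNormedType.Exports.

Local Open Scope classical_set_scope.
Local Open Scope ring_scope.

(* A function on R_+, on a compact interval or on a triangle of times is
   represented by a total function, constrained on that domain only. *)

Section Norms.
Context {R : realType} {V : normedModType R}.
Implicit Type f : V -> V.

(* Both norms are valued in \bar R: +oo means unbounded / not Lipschitz.  On the
   zero space lip_norm f is the supremum of the empty set, -oo, which lies below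
   every nonnegative bound, as 0 does. *)
Definition sup_norm f : \bar R := ereal_sup [set `|f a|%:E | a in [set: V]].

Definition lip_norm f : \bar R :=
  ereal_sup [set (`|f ab.1 - f ab.2| / `|ab.1 - ab.2|)%:E
            | ab in [set ab : V * V | ab.1 != ab.2]].

End Norms.

Section Data.
Context {R : realType}.
Implicit Types r s t x y tau : R.

(* omega s t stands for omega_{s,t}; continuity near the diagonal is the
   continuity, relative to the triangle of times, at every point (s, s). *)
Record control (T : R) (omega : R -> R -> R) : Prop := {
  control_ge0 : forall s t, 0 <= s -> s <= t -> t <= T -> 0 <= omega s t ;
  control_superadditive : forall r s t, 0 <= r -> r <= s -> s <= t -> t <= T ->
    omega r s + omega s t <= omega r t ;
  control_continuous : forall s, 0 <= s -> s <= T ->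
    omega p.1 p.2 @[p --> within [set p : R * R | 0 <= p.1 <= p.2 /\ p.2 <= T]
                            (nbhs (s, s))] --> omega s s ;
  control_diag : forall s, 0 <= s -> s <= T -> omega s s = 0 }.

(* A remainder on [0, W], in use with W = omega 0 T.  If 0 < W, the condition
   at 0 follows by letting tau tend to 0 in remainder_half; it matters only
   for W = 0, where remainder_half is void. *)
Record remainder (W kappa : R) (varpi : R -> R) : Prop := {
  remainder_kappa : 0 < kappa < 1 ;
  remainder_ge0 : forall x, 0 <= x <= W -> 0 <= varpi x ;
  remainder_continuous : {within `[0, W], continuous varpi} ;
  remainder_increasing : {in `[0, W] &, {homo varpi : x y / x < y}} ;
  remainder_half : forall tau, 0 < tau <= W ->
    2 * varpi (tau / 2) <= kappa * varpi tau ;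
  remainder_at0 : varpi 0 = 0 }.

Record vanishing_modulus (delta : R -> R) : Prop := {
  modulus_ge0 : forall x, 0 <= x -> 0 <= delta x ;
  modulus_nondecreasing : forall x y, 0 <= x -> x <= y -> delta x <= delta y ;
  modulus_cvg0 : delta x @[x --> 0^'+] --> 0 }.

End Data.

Section Flows.
Context {R : realType} {V : normedModType R}.
Implicit Types r s t u v x y alpha : R.

Record four_points_control (f : V -> V) (fhat : R -> R) (fdag : R) : Prop := {
  fhat_ge0 : forall x, 0 <= x -> 0 <= fhat x ;
  fhat_nondecreasing : forall x y, 0 <= x -> x <= y -> fhat x <= fhat y ;
  fhat_continuous : {within `[0, +oo[, continuous fhat} ;
  fdag_ge0 : 0 <= fdag ;
  four_points : forall a b c d : V,
    `|f a - f b - f c + f d|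
      <= fhat (Num.max `|a - b| `|c - d|) * Num.max `|a - c| `|b - d|
         + fdag * `|a - b - c + d| }.

(* In phi t s, as in phi_{t,s}, the final time comes first. *)
Definition flow_defect (phi : R -> R -> V -> V) (t s r : R) : V -> V :=
  (phi t s \o phi s r) \- phi t r.

(* The witnesses delta, M, C, phihat, phistar of the almost flow property are
   parameters, so that a statement can refer to them. *)
Record stable_almost_flow (T : R) (omega : R -> R -> R) (varpi delta : R -> R)
    (M C : R) (phihat : R -> R -> R -> R) (phistar : R -> R)
    (phi : R -> R -> V -> V) : Prop := {
  saf_continuous : forall s t, 0 <= s -> s <= t -> t <= T ->
    continuous (phi t s) ;
  saf_delta : vanishing_modulus delta ;
  saf_M_ge0 : 0 <= M ;
  saf_C_ge0 : 0 <= C ;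
  saf_id : forall t, 0 <= t -> t <= T -> phi t t = id ;
  saf_near_id : forall T' : R, 0 < T' -> T' <= T ->
    forall s t, 0 <= s -> s <= t -> t <= T' ->
    (sup_norm (phi t s \- id)%R <= (delta T')%:E)%E ;
  saf_lip : forall T' : R, 0 < T' -> T' <= T ->
    forall s t, 0 <= s -> s <= t -> t <= T' ->
    (lip_norm (phi t s) <= (1 + delta T')%:E)%E ;
  saf_defect_sup : forall r s t, 0 <= r -> r <= s -> s <= t -> t <= T ->
    (sup_norm (flow_defect phi t s r) <= (M * varpi (omega r t))%:E)%E ;
  saf_four_points : exists phidag : R -> R -> R,
    (forall s t, 0 <= s -> s <= t -> t <= T ->
      four_points_control (phi t s) (phihat t s) (phidag t s)) /\
    (forall T' : R, 0 < T' -> T' <= T ->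
      forall s t, 0 <= s -> s <= t -> t <= T' -> phidag t s <= 1 + delta T') ;
  saf_phihat_mono : forall u s t v,
    0 <= u -> u <= s -> s <= t -> t <= v -> v <= T ->
    forall x, 0 <= x -> phihat t s x <= phihat v u x ;
  saf_phistar_ge0 : forall alpha, 0 <= alpha -> 0 <= phistar alpha ;
  saf_compatible : forall s t, 0 <= s -> s <= t -> t <= T ->
    forall alpha, 0 <= alpha ->
    phihat t s (alpha * varpi (omega s t)) <= phistar alpha * varpi (omega s t) ;
  saf_defect_lip : forall r s t, 0 <= r -> r <= s -> s <= t -> t <= T ->
    (lip_norm (flow_defect phi t s r) <= (C * varpi (omega r t))%:E)%E }.

(* flow_along phi t s [:: u1; ...; un] =
     phi t un \o phi un u_{n-1} \o ... \o phi u2 u1 \o phi u1 s. *)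
Fixpoint flow_along (phi : R -> R -> V -> V) (t s : R) (us : seq R) : V -> V :=
  if us is u :: us' then flow_along phi t u us' \o phi u s else phi t s.

(* The iterated product along the partition of [0, T'] whose points, in
   increasing order, are those of 0 :: p, where itv_partition 0 T' p. *)
Definition iterated_product (phi : R -> R -> V -> V) (p : seq R) (t s : R) :
    V -> V :=
  flow_along phi t s [seq u <- 0 :: p | s <= u <= t].

End Flows.

(* Main.v *)
Require Import Defs.
From HB Require Import structures.
From mathcomp Require Import all_boot all_order all_algebra.
From mathcomp Require Import all_classical all_reals all_analysis.
From mathcomp Require Import ring lra.

Set Implicit Arguments.
Unset Strict Implicit.
Unset Printing Implicit Defensive.

Import Order.TTheory GRing.Theory Num.Theory.
Import numFieldNormedType.Exports.

Local Open Scope classical_set_scope.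
Local Open Scope ring_scope.

(** Write psi for an iterated product of phi and D = psi - phi for its error.
    Splitting the partition at one of its points u, s <= u <= t, gives
      D_{t,s} = D_{t,u} o psi_{u,s} + (phi_{t,u} o psi_{u,s} - phi_{t,u} o phi_{u,s})
                + (phi_{t,u} o phi_{u,s} - phi_{t,s}),
    so the error over [s, t] is controlled by the errors over the two pieces
    plus a source of order varpi (omega_{s,t}) (lemma flow_error_split).

    Any size of error that obeys such a rule
      size [s,t] <= q size [s,u] + q size [u,t] + K varpi (omega_{s,t})
    is at most L varpi (omega_{s,t}) as soon as q^2 kappa < 1 (sewing_bound).
    Indeed one may split twice, at consecutive points u and v such that
    [s, u] and [v, t] each carry at most half of omega_{s,t}; the middle piece
    [u, v] has no error, and each outer piece contributes by induction at most
    L kappa / 2 varpi (omega_{s,t}).  The constant L solves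
    q^2 kappa L + (q + 1) K = L.

    The rule is used twice.  For the sup norm it holds with q >= 1 + delta and
    K = M (flow_error_sup), whence |psi - phi| <= L0 varpi(omega).  For the
    Lipschitz norm (flow_error_lip) the middle term of the splitting is a second
    difference of phi_{t,u} at psi a, phi a, psi b, phi b.  The 4-points control
    bounds it by phihat (|psi - phi|) * Lip psi * |a - b| + (1 + delta) * Lip D *
    |a - b|; the sup bound and the compatibility of phihat with varpi turn the
    first factor into phistar(L0) varpi(omega), which joins the source.  What
    remains nonlinear is the factor Lip psi <= 1 + delta + Lip D: it stays below q
    because the horizon T0 is chosen, after L, such that delta T0 and
    L varpi (omega_{0,T0}) are at most a small eps.  This is possible because
    varpi (omega_{0,x}) tends to 0 with x (remainder_control_cvg0).

    Finally Lip psi <= Lip phi + Lip D yields the uniform Lipschitz bound with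
    delta' x = delta x + L varpi (omega_{0,x}), with x replaced by T0 beyond T0. *)

(** * Controls and remainders *)

Section ControlRemainder.
Context {R : realType}.
Implicit Types (r s t u x y : R) (us : seq R).

Lemma control_le (T : R) omega r s t u : control T omega ->
  0 <= r -> r <= s -> s <= t -> t <= u -> u <= T -> omega s t <= omega r u.
Proof.
move=> h r0 rs st tu uT.
have s0 := le_trans r0 rs; have t0 := le_trans s0 st; have tT := le_trans tu uT.
have st_rt := control_superadditive h r0 rs st tT.
have rt_ru := control_superadditive h r0 (le_trans rs st) tu uT.
have rs0 := control_ge0 h r0 rs (le_trans st tT).
have tu0 := control_ge0 h t0 tu uT.
lra.
Qed.

Lemma remainder_le (W kappa : R) varpi x y : remainder W kappa varpi ->
  0 <= x -> x <= y -> y <= W -> varpi x <= varpi y.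
Proof.
move=> h x0; rewrite le_eqVlt => /orP[/eqP-> //|xy] yW.
by apply/ltW/(remainder_increasing h); rewrite // in_itv /=; lra.
Qed.

Lemma remainder_half_le (W kappa : R) varpi x y : remainder W kappa varpi ->
  0 <= x -> x <= y / 2 -> y <= W -> 2 * varpi x <= kappa * varpi y.
Proof.
move=> h x0 xy yW; have [y0|y0] := ltP 0 y.
  have yW' : 0 < y <= W by rewrite y0.
  apply: le_trans (remainder_half h yW').
  rewrite ler_pM2l; last by lra.
  by apply: (remainder_le h) => //; lra.
have -> : x = 0 by lra.
have -> : y = 0 by lra.
by rewrite (remainder_at0 h) !mulr0.
Qed.

Lemma remainder_control_ge0 (T kappa : R) omega varpi s t :
  control T omega -> remainder (omega 0 T) kappa varpi ->
  0 <= s -> s <= t -> t <= T -> 0 <= varpi (omega s t).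
Proof.
move=> hw hv s0 st tT; apply: (remainder_ge0 hv).
by rewrite (control_ge0 hw) // (control_le hw).
Qed.

Lemma remainder_control_le (T kappa : R) omega varpi r s t u :
  control T omega -> remainder (omega 0 T) kappa varpi ->
  0 <= r -> r <= s -> s <= t -> t <= u -> u <= T ->
  varpi (omega s t) <= varpi (omega r u).
Proof.
move=> hw hv r0 rs st tu uT.
have s0 := le_trans r0 rs; have su := le_trans st tu.
apply: (remainder_le hv).
- by apply: (control_ge0 hw) => //; apply: le_trans uT.
- exact: (control_le hw).
- by apply: (control_le hw) => //; apply: le_trans su.
Qed.

Lemma cvg_within_in {S : Type} {X : topologicalType} (F : set_system S)
    {FF : Filter F} (f : S -> X) (D : set X) (l : X) :
  f @ F --> l -> (\forall x \near F, D (f x)) -> f @ F --> within D (nbhs l).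
Proof. by move=> fl fD A /fl; apply: filterS2 fD => x Dx; apply. Qed.

Lemma remainder_control_cvg0 (T kappa : R) omega varpi : 0 < T ->
  control T omega -> remainder (omega 0 T) kappa varpi ->
  varpi (omega 0 x) @[x --> 0^'+] --> 0.
Proof.
move=> T0 hw hv.
have x_in : \forall x \near (0 : R)^'+, 0 <= x <= T.
  near=> x; apply/andP; split; last by near: x; exact: nbhs_right_le.
  by apply/ltW; near: x; exact: nbhs_right_gt.
have hw0 : omega 0 x @[x --> 0^'+] --> (0 : R).
  have pair_cvg : (0, x) @[x --> (0 : R)^'+] -->
      within [set p : R * R | 0 <= p.1 <= p.2 /\ p.2 <= T] (nbhs (0, 0)).
    apply: cvg_within_in.
      exact: (cvg_pair (cvg_cst _) (cvg_at_right_filter cvg_id)).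
    by apply: filterS x_in => x /andP[x0 xT] /=; rewrite lexx x0.
  have := cvg_comp _ _ pair_cvg (control_continuous hw (lexx 0) (ltW T0)).
  by rewrite (control_diag hw (lexx 0) (ltW T0)).
have W0 := control_ge0 hw (lexx 0) (ltW T0) (lexx T).
have /subspace_continuousP /(_ 0) := remainder_continuous hv.
rewrite /from_subspace (remainder_at0 hv) /= in_itv /= lexx W0 => /(_ isT) hv0.
apply: (cvg_comp _ _ _ hv0); apply: cvg_within_in => //.
apply: filterS x_in => x /andP[x0 xT] /=.
by rewrite in_itv /= (control_ge0 hw) // (control_le hw).
Unshelve. all: by end_near. Qed.

End ControlRemainder.

(** * Dyadic splitting of a partition *)

Section Splitting.
Context {R : realType}.
Implicit Types (r s t u x y : R) (us : seq R).

(** The points us are nondecreasing and lie in [s, t].  Repetitions and the end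
    points are allowed, so that both pieces of a split chain are chains. *)
Definition chain s us t : bool := path <=%R s (rcons us t).

Lemma chain_split s us1 u us2 t :
  chain s (us1 ++ u :: us2) t = chain s us1 u && chain u us2 t.
Proof. by rewrite /chain rcons_cat cat_path /= (rcons_path _ _ us1) andbA. Qed.

Lemma chain_le s us t : chain s us t -> s <= t.
Proof.
elim: us s => [|u us IH] s; first by rewrite /chain /= andbT.
move=> /andP[su ust]; exact: le_trans su (IH u ust).
Qed.

(** The solution L of q^2 kappa L + (q + 1) K = L. *)
Definition fixpoint_bound (kappa q K : R) : R :=
  (q + 1) * K / (1 - q ^+ 2 * kappa).

Lemma fixpoint_boundE (kappa q K : R) : q ^+ 2 * kappa < 1 ->
  q ^+ 2 * kappa * fixpoint_bound kappa q K + (q + 1) * K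
  = fixpoint_bound kappa q K.
Proof.
rewrite -subr_gt0 => /lt0r_neq0 d0.
by rewrite /fixpoint_bound; field.
Qed.

Lemma fixpoint_bound_ge0 (kappa q K : R) :
  0 <= q -> q ^+ 2 * kappa < 1 -> 0 <= K -> 0 <= fixpoint_bound kappa q K.
Proof. by move=> q0 qk K0; rewrite divr_ge0 ?mulr_ge0 //; lra. Qed.

(** E s us t x is meant to say that an error attached to the chain us of [s, t]
    is at most x.  The rule for joining two chains is only required when the
    error of the left one is at most eps, which leaves room for a nonlinear
    dependence on it; the smallness of L * varpi (omega 0 T0) keeps the
    induction within that range. *)
Lemma sewing_bound (T T0 kappa : R) (omega : R -> R -> R) (varpi : R -> R)
    (E : R -> seq R -> R -> R -> Prop) (q K eps : R)
    (L := fixpoint_bound kappa q K) :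
  control T omega -> remainder (omega 0 T) kappa varpi -> T0 <= T ->
  1 <= q -> q ^+ 2 * kappa < 1 -> 0 <= K ->
  L * varpi (omega 0 T0) <= eps ->
  (forall s us t x y, E s us t x -> x <= y -> E s us t y) ->
  (forall s t, 0 <= s -> s <= t -> t <= T0 -> E s [::] t 0) ->
  (forall s us1 u us2 t x y,
    0 <= s -> chain s us1 u -> chain u us2 t -> t <= T0 ->
    0 <= x <= eps -> 0 <= y -> E s us1 u x -> E u us2 t y ->
    E s (us1 ++ u :: us2) t (q * x + q * y + K * varpi (omega s t))) ->
  forall s us t, 0 <= s -> chain s us t -> t <= T0 ->
  E s us t (L * varpi (omega s t)).
Proof.
move=> hw hv T0T q1 qk K0 Leps Emono Enil Esplit s us t.
have L0 : 0 <= L by apply: fixpoint_bound_ge0 => //; lra.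
have LK : q ^+ 2 * kappa * L + (q + 1) * K <= L by rewrite fixpoint_boundE.
move: L Leps L0 LK => L Leps L0 LK.
have [n] := ubnP (size us); elim: n => // n IH in s us t *.
move=> us_lt s0 sust tT0; have st := chain_le sust; have tT := le_trans tT0 T0T.
have rho0 a b : s <= a -> a <= b -> b <= t -> 0 <= L * varpi (omega a b).
  move=> sa ab bt; rewrite mulr_ge0 // (remainder_control_ge0 hw hv) //.
    exact: le_trans sa.
  exact: le_trans tT.
have [us0|us_gt0] := boolP (us == [::]).
  by rewrite (eqP us0); apply: Emono (rho0 s t _ _ _) => //; apply: Enil.
set w := varpi (omega s t).
have w0 : 0 <= w by apply: (remainder_control_ge0 hw hv).
(* H bounds the error of any piece that carries at most half of omega s t *)
pose H := L * (kappa * w / 2).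
have small a b : s <= a -> a <= b -> b <= t -> omega a b <= omega s t / 2 ->
    L * varpi (omega a b) <= H.
  move=> sa ab bt ab_half; rewrite ler_wpM2l // ler_pdivlMr // mulrC.
  apply: (remainder_half_le hv) => //.
    by apply: (control_ge0 hw) => //; [apply: le_trans sa|apply: le_trans tT].
  exact: (control_le hw).
have leps a b : s <= a -> a <= b -> b <= t -> L * varpi (omega a b) <= eps.
  move=> sa ab bt; apply: le_trans Leps; rewrite ler_wpM2l //.
  by apply: (remainder_control_le hw hv) => //;
    [apply: le_trans sa|apply: le_trans tT0].
have kappa0 : 0 < kappa by have /andP[] := remainder_kappa hv.
have H0 : 0 <= H by rewrite mulr_ge0 // divr_ge0 // mulr_ge0 // ltW.
have qH0 : 0 <= q * H by rewrite mulr_ge0 //; lra.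
have qH : q * H <= q * (q * H) by rewrite ler_peMl // mulr_ge0 //; lra.
have Kw : 0 <= K * w by rewrite mulr_ge0.
have qKw : K * w <= q * (K * w) by rewrite ler_peMl.
have total : q * H + q * (q * H) + q * (K * w) + K * w <= L * w.
  have: (q ^+ 2 * kappa * L + (q + 1) * K) * w <= L * w by rewrite ler_wpM2r.
  have : q ^+ 2 * kappa * L * w = 2 * (q * (q * H)) by rewrite /H; field.
  lra.
(* v is the first point past which more than half of omega s t is used: by
   superadditivity at most half remains on [v, t].  If there is none, the last
   point of the chain is a good place for a single split. *)
have [has_u|] := boolP (has (fun u => omega s t / 2 < omega s u) us); last first.
  case/lastP: us us_lt sust us_gt0 => // us u.
  rewrite -cats1 chain_split size_cat /= addn1 ltnS => us_lt /andP[sus ut] _.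
  rewrite has_cat negb_or /= orbF -leNgt => /andP[_ su_half].
  have su := chain_le sus; have {}ut' := chain_le ut.
  apply: Emono
    (Esplit s us u [::] t (L * varpi (omega s u)) 0 _ _ _ _ _ _ _ _) _ => //.
  - by rewrite rho0 // leps.
  - by apply: IH => //; apply: le_trans tT0.
  - by apply: Enil => //; apply: le_trans su.
  - have := small s u (lexx s) su ut' su_half.
    move=> /(ler_wpM2l (le_trans ler01 q1)); rewrite -/w; lra.
have [us1 [v [us2 [v_half us1_half def_us]]]] : exists us1 v us2,
    [/\ omega s t / 2 < omega s v, ~~ has (fun u => omega s t / 2 < omega s u) us1
      & us = us1 ++ v :: us2].
  case: (split_find has_u) => v us1 us2 v_half us1_half.
  by exists us1, v, us2; rewrite -cats1 -catA.
move: us_lt sust; rewrite def_us size_cat /= addnS ltnS => us_lt.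
rewrite chain_split => /andP[s1v v2t] {def_us}.
have sv := chain_le s1v; have vt := chain_le v2t; have v0 := le_trans s0 sv.
have vt_half : omega v t <= omega s t / 2.
  by have := control_superadditive hw s0 sv vt tT; lra.
have Ev : E v us2 t (L * varpi (omega v t)).
  by apply: IH => //; apply: leq_ltn_trans us_lt; rewrite leq_addl.
have qHv := ler_wpM2l (le_trans ler01 q1) (small v t sv vt (lexx t) vt_half).
(* u is the predecessor of v; without one, [s, v] has no interior point and
   the single split at v is enough *)
case/lastP: us1 => [|us1 u] in us_lt us1_half s1v *.
  apply: Emono (Esplit s [::] v us2 t 0 _ _ _ _ _ _ _ _ Ev) _ => //.
  - by rewrite lexx (le_trans (rho0 _ _ (lexx s) (lexx s) st)) // leps.
  - exact: rho0.
  - by apply: Enil => //; apply: le_trans vt tT0.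
  - rewrite -/w; lra.
move: us_lt s1v us1_half; rewrite -cats1 chain_split has_cat negb_or /= orbF.
rewrite size_cat addn1 addSn => us_lt /andP[s1u uv] /andP[_]; rewrite -leNgt.
move=> su_half; have su := chain_le s1u; have {}uv' := chain_le uv.
have u0 := le_trans s0 su; have ut := le_trans uv' vt.
have Eu : E s us1 u (L * varpi (omega s u)).
  apply: IH => //; last exact: le_trans tT0.
  by apply: leq_ltn_trans (ltnW us_lt); rewrite leq_addr.
have qHu := ler_wpM2l (le_trans ler01 q1) (small s u (lexx s) su ut su_half).
(* the empty chain of [u, v] has error 0; joining it to the right piece first
   means that the left error fed to each join is 0 or an inductive bound, hence
   at most eps *)
have Eut : E u (v :: us2) t
    (q * 0 + q * (L * varpi (omega v t)) + K * varpi (omega u t)).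
  apply: (Esplit u [::] v us2 t) => //;
    last by apply: Enil => //; exact: le_trans tT0.
  - by rewrite lexx (le_trans (rho0 _ _ (lexx s) (lexx s) st)) // leps.
  - exact: rho0.
have ut_st : K * varpi (omega u t) <= K * w.
  by rewrite ler_wpM2l // (remainder_control_le hw hv).
have ut0 : 0 <= K * varpi (omega u t).
  by rewrite mulr_ge0 // (remainder_control_ge0 hw hv).
have q0 : 0 <= q by lra.
have vt0 : 0 <= q * (L * varpi (omega v t)) by rewrite mulr_ge0 // rho0.
rewrite -catA /=.
apply: Emono (Esplit s us1 u (v :: us2) t _ _ _ _ _ _ _ _ Eu Eut) _ => //.
- by rewrite /chain /=; move: uv; rewrite /chain /= andbT => ->.
- by rewrite rho0 // leps.
- lra.
rewrite -/w.
have : q * (q * 0 + q * (L * varpi (omega v t)) + K * varpi (omega u t))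
    <= q * (q * H + K * w) by rewrite ler_wpM2l //; lra.
rewrite mulrDr; lra.
Qed.

End Splitting.

(** * Sup-norm and Lipschitz errors of iterated products *)

Section Norms.
Context {R : realType} {V : normedModType R}.
Implicit Types (f : V -> V) (a b : V) (K : R).

Lemma sup_norm_le f K : (sup_norm f <= K%:E)%E -> forall a, `|f a| <= K.
Proof. by move=> /ereal_supP h a; rewrite -lee_fin; apply: h; exists a. Qed.

Lemma lip_norm_le f K : (lip_norm f <= K%:E)%E <->
  forall a b, `|f a - f b| <= K * `|a - b|.
Proof.
split=> [/ereal_supP h a b|h].
  have [->|ab] := eqVneq a b; first by rewrite !subrr normr0 mulr0.
  rewrite -ler_pdivrMr ?normr_gt0 ?subr_eq0 // -lee_fin.
  by apply: h; exists (a, b).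
apply/ereal_supP => _ [[a b] /= ab <-].
by rewrite lee_fin ler_pdivrMr ?normr_gt0 ?subr_eq0.
Qed.

End Norms.

Section Errors.
Context {R : realType} {V : normedModType R}.
Implicit Types (phi : R -> R -> V -> V) (s t u : R) (us : seq R) (a b : V).

Lemma flow_along_cat phi s us1 u us2 t :
  flow_along phi t s (us1 ++ u :: us2)
  = flow_along phi t u us2 \o flow_along phi u s us1.
Proof. by elim: us1 s => //= u1 us1 IH s; rewrite IH. Qed.

Definition flow_error phi s us t : V -> V := flow_along phi t s us \- phi t s.

(** Telescoping through phi t u \o flow_along phi u s us1 and
    phi t u \o phi u s. *)
Lemma flow_error_split phi s us1 u us2 t a :
  flow_error phi s (us1 ++ u :: us2) t a
  = flow_error phi u us2 t (flow_along phi u s us1 a)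
    + (phi t u (flow_along phi u s us1 a) - phi t u (phi u s a))
    + flow_defect phi t u s a.
Proof. by rewrite /flow_error /flow_defect flow_along_cat /= !subrKA. Qed.

Lemma flow_along_sub phi s us t a b :
  flow_along phi t s us a - flow_along phi t s us b
  = flow_error phi s us t a - flow_error phi s us t b + (phi t s a - phi t s b).
Proof.
rewrite /flow_error /= opprB -addrA.
by rewrite (addrC (phi t s b - _)) !subrKA.
Qed.

Variables (T T0 kappa q eps M C : R) (omega : R -> R -> R).
Variables (varpi delta : R -> R) (phihat : R -> R -> R -> R) (phistar : R -> R).
Variable phi : R -> R -> V -> V.
Hypotheses (homega : control T omega).
Hypotheses (hvarpi : remainder (omega 0 T) kappa varpi).
Hypothesis (hphi :
  stable_almost_flow T omega varpi delta M C phihat phistar phi).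
Hypotheses (T0_gt0 : 0 < T0) (T0_le : T0 <= T).
Hypotheses (eps_ge0 : 0 <= eps) (q_ge : 1 + delta T0 + eps <= q).
Hypothesis (q_lt : q ^+ 2 * kappa < 1).

Lemma delta_ge0 : 0 <= delta T0.
Proof. exact: (modulus_ge0 (saf_delta hphi)) (ltW T0_gt0). Qed.

Lemma q_ge1 : 1 <= q.
Proof. by have := delta_ge0; have := eps_ge0; have := q_ge; lra. Qed.

Lemma phi_lip s t a b : 0 <= s -> s <= t -> t <= T0 ->
  `|phi t s a - phi t s b| <= (1 + delta T0) * `|a - b|.
Proof.
by move=> s0 st tT0; apply/lip_norm_le: a b; apply: (saf_lip hphi).
Qed.

(** Here the rule for joining errors is linear, so eps is taken to be the final
    bound itself and no smallness of the horizon is needed beyond q_ge and q_lt. *)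
Lemma flow_error_sup s us t : 0 <= s -> chain s us t -> t <= T0 ->
  forall a, `|flow_error phi s us t a|
            <= fixpoint_bound kappa q M * varpi (omega s t).
Proof.
have dl0 := delta_ge0; have M0 := saf_M_ge0 hphi.
move: s us t; pose eps' := fixpoint_bound kappa q M * varpi (omega 0 T0).
apply: (sewing_bound (E := fun s us t x =>
  forall a, `|flow_error phi s us t a| <= x) (q := q) (K := M) (eps := eps')
  homega hvarpi) => //.
- exact: q_ge1.
- by move=> s us t x y h xy a; apply: le_trans xy.
- by move=> s t _ _ _ a; rewrite /flow_error /= subrr normr0.
move=> s us1 u us2 t x y s0 su ut tT0 /andP[x0 _] y0 hx hy a.
have {}su := chain_le su; have {}ut := chain_le ut.
have u0 := le_trans s0 su.
rewrite flow_error_split; apply: le_trans (ler_normD _ _) _.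
rewrite lerD //; last first.
  by apply: (sup_norm_le (saf_defect_sup hphi s0 su ut _)); apply: le_trans T0_le.
apply: le_trans (ler_normD _ _) _; rewrite addrC lerD //.
  apply: le_trans (phi_lip _ _ u0 ut tT0) _.
  apply: ler_pM => //; last exact: hx.
  - by lra.
  - by have := eps_ge0; have := q_ge; lra.
by apply: le_trans (hy _) _; rewrite ler_peMl // q_ge1.
Qed.

(** The coefficient of varpi (omega s t) * `|a - b| in the rule for joining
    Lipschitz errors: phistar (L0) * q comes from the 4-points control, L0 being
    the constant of the sup bound, and C from the defect. *)
Definition lip_source : R := phistar (fixpoint_bound kappa q M) * q + C.

Lemma lip_source_ge0 : 0 <= lip_source.
Proof.
have q0 : 0 <= q := le_trans ler01 q_ge1.
rewrite addr_ge0 ?mulr_ge0 ?(saf_C_ge0 hphi) // (saf_phistar_ge0 hphi) //.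
exact: fixpoint_bound_ge0 (saf_M_ge0 hphi).
Qed.

(** The sup bound makes psi a and phi a close, so that the 4-points control of
    the outer map phi t u costs only a multiple of varpi (omega s t); the bound
    eps on the Lipschitz error of the left piece gives Lip psi <= q. *)
Lemma flow_error_lip s us t :
  fixpoint_bound kappa q lip_source * varpi (omega 0 T0) <= eps ->
  0 <= s -> chain s us t -> t <= T0 ->
  forall a b, `|flow_error phi s us t a - flow_error phi s us t b|
              <= fixpoint_bound kappa q lip_source * varpi (omega s t) * `|a - b|.
Proof.
move=> Leps; move: s us t.
have dl0 := delta_ge0; have M0 := saf_M_ge0 hphi.
have q1 := q_ge1.
have q0 : 0 <= q by lra.
have L0 := fixpoint_bound_ge0 q0 q_lt M0.
have K0 := lip_source_ge0.
apply: (sewing_bound (E := fun s us t x => forall a b,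
  `|flow_error phi s us t a - flow_error phi s us t b| <= x * `|a - b|)
  (q := q) (K := lip_source) (eps := eps) homega hvarpi) => //.
- move=> s us t x y h xy a b; apply: le_trans (h a b) _.
  by rewrite ler_wpM2r.
- by move=> s t _ _ _ a b; rewrite /flow_error /= !subrr normr0 mul0r.
move=> s us1 u us2 t x y s0 s1u u2t tT0 /andP[x0 xeps] y0 hx hy a b.
have su := chain_le s1u; have ut := chain_le u2t; have u0 := le_trans s0 su.
have st := le_trans su ut; have tT := le_trans tT0 T0_le.
have uT0 := le_trans ut tT0.
set psi := flow_along phi u s us1.
have psi_lip : `|psi a - psi b| <= q * `|a - b|.
  rewrite /psi flow_along_sub.
  apply: le_trans (ler_normD _ _) _.
  apply: le_trans (lerD (hx a b) (phi_lip _ _ s0 su uT0)) _.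
  rewrite -mulrDl ler_wpM2r //; have := q_ge; lra.
have psi_near c :
    `|psi c - phi u s c| <= fixpoint_bound kappa q M * varpi (omega s t).
  apply: le_trans (flow_error_sup s0 s1u uT0 c) _; rewrite ler_wpM2l //.
  exact: (remainder_control_le homega hvarpi).
rewrite !flow_error_split -/psi.
set e2a := flow_error phi u us2 t _; set e2b := flow_error phi u us2 t (psi b).
set da := flow_defect _ _ _ _ a; set db := flow_defect _ _ _ _ b.
set Q := phi t u.
have -> : e2a + (Q (psi a) - Q (phi u s a)) + da
        - (e2b + (Q (psi b) - Q (phi u s b)) + db)
    = (e2a - e2b)
      + (Q (psi a) - Q (phi u s a) - Q (psi b) + Q (phi u s b)) + (da - db).
  have -> : Q (psi a) - Q (phi u s a) - Q (psi b) + Q (phi u s b)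
      = (Q (psi a) - Q (phi u s a)) - (Q (psi b) - Q (phi u s b)).
    by rewrite opprB addrA addrAC.
  set Ea := Q (psi a) - _; set Eb := Q (psi b) - _.
  by rewrite opprD addrACA (opprD e2b) (addrACA e2a).
have he2 : `|e2a - e2b| <= q * y * `|a - b|.
  apply: le_trans (hy _ _) _.
  by rewrite [q * y]mulrC -mulrA ler_wpM2l.
have hd : `|da - db| <= C * varpi (omega s t) * `|a - b|.
  exact: (proj1 (lip_norm_le _ _) (saf_defect_lip hphi s0 su ut tT)).
have [dag [hfour hdag]] := saf_four_points hphi.
have h4 := hfour _ _ u0 ut tT.
have hQ : `|Q (psi a) - Q (phi u s a) - Q (psi b) + Q (phi u s b)|
    <= phistar (fixpoint_bound kappa q M) * varpi (omega s t) * (q * `|a - b|)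
       + q * (x * `|a - b|).
  apply: le_trans (four_points h4 _ _ _ _) _; apply: lerD; apply: ler_pM => //.
  - by apply: (fhat_ge0 h4); rewrite le_max normr_ge0.
  - apply: le_trans (saf_compatible hphi s0 st tT L0).
    apply: le_trans (saf_phihat_mono hphi s0 su ut (lexx t) tT _).
      apply: (fhat_nondecreasing h4); first by rewrite le_max normr_ge0.
      by rewrite ge_max !psi_near.
    by rewrite mulr_ge0 // (remainder_control_ge0 homega hvarpi).
  - rewrite ge_max psi_lip /=; apply: le_trans (phi_lip _ _ s0 su uT0) _.
    by rewrite ler_wpM2r //; have := eps_ge0; have := q_ge; lra.
  - exact: (fdag_ge0 h4).
  - apply: le_trans (hdag _ T0_gt0 T0_le _ _ u0 ut tT0) _.
    by have := eps_ge0; have := q_ge; lra.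
  - apply: le_trans (hx a b); rewrite /flow_error /= -/psi opprB.
    by rewrite !addrA addrAC.
apply: le_trans (ler_normD _ _) _.
apply: le_trans (lerD (le_trans (ler_normD _ _) (lerD he2 hQ)) hd) _.
by rewrite /lip_source; lra.
Qed.

End Errors.

(** * The uniform Lipschitz condition *)

Lemma chain_filter {R : realType} (ps : seq R) (s t : R) : s <= t ->
  sorted <%R ps -> chain s [seq u <- ps | s <= u <= t] t.
Proof.
move=> st ps_sorted; have tr : transitive (<=%R : rel R) := le_trans.
rewrite /chain (path_pairwise tr) pairwise_cons all_rcons pairwise_rcons st /=.
rewrite -(sorted_pairwise tr); apply/and3P; split.
- by apply/allP => u; rewrite mem_filter => /andP[/andP[]].
- by apply/allP => u; rewrite mem_filter => /andP[/andP[]].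
- by apply: sorted_filter tr _ _ _; exact: (sub_sorted (@ltW _ _)).
Qed.

(** omega 0 is only meaningful up to the horizon, hence the minimum. *)
Lemma vanishing_modulus_add (R : realType) (T T0 kappa L : R) omega varpi delta :
  0 < T0 -> T0 <= T -> 0 <= L ->
  control T omega -> remainder (omega 0 T) kappa varpi ->
  vanishing_modulus delta ->
  vanishing_modulus
    (fun x => delta x + L * varpi (omega 0 (Num.min x T0))).
Proof.
move=> T0_gt0 T0T L0 hw hv hd.
have minT x : Num.min x T0 <= T by rewrite ge_min T0T orbT.
have min0 x : 0 <= x -> 0 <= Num.min x T0 by rewrite le_min (ltW T0_gt0) andbT.
split=> [x x0|x y x0 xy|].
- by rewrite addr_ge0 ?(modulus_ge0 hd) // mulr_ge0 //
    (remainder_control_ge0 hw hv) // min0.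
- rewrite lerD ?(modulus_nondecreasing hd) // ler_wpM2l //.
  apply: (remainder_control_le hw hv) => //; first exact: min0.
  by rewrite le_min !ge_min xy lexx orbT.
- rewrite -[X in _ --> X]addr0; apply: cvgD; first exact: (modulus_cvg0 hd).
  rewrite -[X in _ --> X](mulr0 L); apply: cvgM; first exact: cvg_cst.
  apply: cvg_trans (remainder_control_cvg0 (lt_le_trans T0_gt0 T0T) hw hv).
  apply: near_eq_cvg; near=> x; rewrite min_l //.
  by near: x; exact: nbhs_right_le.
Unshelve. all: by end_near. Qed.

(** With kappa < 1, eps = (1 - kappa) / 8 leaves room for q > 1 such that
    q^2 kappa < 1; then L is fixed by q and the data, and T0 is taken so small
    that delta T0 <= eps and L varpi (omega 0 T0) <= eps. *)
Theorem theorem2 (R : realType) (T : R) (omega : R -> R -> R)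
    (varpi : R -> R) (kappa : R) (delta : R -> R) (M C : R)
    (phihat : R -> R -> R -> R) (phistar : R -> R)
    (T_gt0 : 0 < T) (homega : control T omega)
    (hvarpi : remainder (omega 0 T) kappa varpi) :
  exists T0 L : R,
    [/\ 0 < T0 <= T,
        0 <= L &
        forall (V : completeNormedModType R) (phi : R -> R -> V -> V),
          stable_almost_flow T omega varpi delta M C phihat phistar phi ->
          (forall p : seq R, itv_partition 0 T0 p ->
            forall s t : R, 0 <= s -> s <= t -> t <= T0 ->
            (lip_norm (iterated_product phi p t s \- phi t s)%R
               <= (L * varpi (omega s t))%:E)%E) /\
          (exists delta' : R -> R,
            vanishing_modulus delta' /\
            forall T' : R, 0 < T' -> T' <= T0 ->
            forall p : seq R, itv_partition 0 T' p ->
            forall s t : R, 0 <= s -> s <= t -> t <= T' ->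
            (lip_norm (iterated_product phi p t s)
               <= (1 + delta' T')%:E)%E)].
Proof.
(* T0 has to be chosen before the flow is given; unless delta is a vanishing
   modulus, there is no flow at all *)
have [hdelta|ndelta] := pselect (vanishing_modulus delta); last first.
  exists T, 0; split => [|//|V phi hphi]; first by rewrite T_gt0 lexx.
  by case: ndelta; exact: (saf_delta hphi).
have /andP[kappa0 kappa1] := remainder_kappa hvarpi.
pose eps := (1 - kappa) / 8; pose q := 1 + 2 * eps.
have eps0 : 0 < eps by rewrite /eps; lra.
(* with h = 1 - kappa, q^2 kappa = (1 + h / 4)^2 (1 - h) < 1 *)
have q_lt : q ^+ 2 * kappa < 1 by rewrite /q /eps; nra.
(* the absolute value makes L nonnegative without a flow at hand, that is
   without the signs of M, C and phistar *)
pose L := `|fixpoint_bound kappa q (lip_source kappa q M C phistar)|.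
have rho_cvg : L * varpi (omega 0 x) @[x --> 0^'+] --> 0.
  rewrite -[X in _ --> X](mulr0 L); apply: cvgM; first exact: cvg_cst.
  exact: (remainder_control_cvg0 T_gt0 homega hvarpi).
have [T0 [/andP[T0_gt0 T0_le] dT0 LT0]] : exists T0, [/\ 0 < T0 <= T,
    delta T0 <= eps & L * varpi (omega 0 T0) <= eps].
  near (0 : R)^'+ => T0; exists T0; split.
  - by apply/andP; split; near: T0;
      [exact: nbhs_right_gt|exact: nbhs_right_le].
  - by near: T0; exact: (cvgr_le _ (modulus_cvg0 hdelta)).
  - by near: T0; exact: (cvgr_le _ rho_cvg).
exists T0, L; split; [by rewrite T0_gt0|exact: normr_ge0|move=> V phi hphi].
have q_ge : 1 + delta T0 + eps <= q by rewrite /q; lra.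
have eps_ge0 := ltW eps0.
have LE : L = fixpoint_bound kappa q (lip_source kappa q M C phistar).
  rewrite /L ger0_norm // fixpoint_bound_ge0 //; first by rewrite /q; lra.
  exact: (lip_source_ge0 hphi T0_gt0 eps_ge0 q_ge q_lt).
have err s us t : 0 <= s -> chain s us t -> t <= T0 -> forall a b,
    `|flow_error phi s us t a - flow_error phi s us t b|
      <= L * varpi (omega s t) * `|a - b|.
  rewrite LE in LT0 *.
  exact: (flow_error_lip homega hvarpi hphi T0_gt0 T0_le eps_ge0 q_ge q_lt LT0).
split=> [p [p_sorted _] s t s0 st tT0|].
  apply/lip_norm_le => a b; apply: (err s _ t) => //.
  exact: (@chain_filter R (0 :: p)).
exists (fun x => delta x + L * varpi (omega 0 (Num.min x T0))); split.
  exact: (vanishing_modulus_add T0_gt0 T0_le (normr_ge0 _) homega hvarpi).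
move=> T' T'0 T'T0 p [p_sorted _] s t s0 st tT'.
have T'T := le_trans T'T0 T0_le.
apply/lip_norm_le => a b; rewrite (min_l T'T0).
have /err := @chain_filter R (0 :: p) s t st p_sorted.
move=> /(_ s0 (le_trans tT' T'T0) a b) ab_err.
have /lip_norm_le/(_ a b) ab_phi := saf_lip hphi T'0 T'T s0 st tT'.
rewrite /iterated_product flow_along_sub.
apply: le_trans (ler_normD _ _) _; apply: le_trans (lerD ab_err ab_phi) _.
rewrite addrC -mulrDl addrA ler_wpM2r // lerD2l ler_wpM2l ?normr_ge0 //.
exact: (remainder_control_le homega hvarpi).
Unshelve. all: by end_near. Qed.
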